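(* For every real $\phi$ with $0 \le \phi < \pi/2$, the algorithm $A_{SS}^{\phi}:\mathbb{R}^2\to\mathbb{R}^2$ (defined in the context) is a gathering algorithm for two oblivious robots with $\phi$-static compasses under the semi-synchronous model; that is, for every initial configuration $C(0)$, every fair semi-synchronous execution of $A_{SS}^{\phi}$ by two robots with $\phi$-static compasses starting from $C(0)$ is a gathering execution.
   Context: Robots. Two anonymous oblivious robots $r_0,r_1$ are points in $\mathbb{R}^2$, with position $\mathbf r_i(t)\in\mathbb{R}^2$ of $r_i$ at time $t$ in a global coordinate system $Z$. The configuration at time $t$ is $C(t)=(\mathbf r_0(t),\mathbf r_1(t))$. At time $t$ robot $r_i$ has a local coordinate system $Z_{(i,t)}$ given by $$Z_{(i,t)}(\mathbf p)^T = sc_i(t)\begin{pmatrix}\cos\phi_i(t)&\sin\phi_i(t)\\-\sin\phi_i(t)&\cos\phi_i(t)\end{pmatrix}(\mathbf p-\mathbf r_i(t))^T,$$ where the scaling ratio $sc_i(t)\in(0,\infty)$ and the compass deviation $\phi_i(t)\in(-\pi,\pi]$ are chosen by an adversary. (The scaling ratio may change from cycle to cycle.) Compasses. The compasses are $\phi$-compasses if $|\phi_i(t)|\le\phi$ for $i\in\{0,1\}$ and all $t\in\mathbb{N}$ (where $0\in\mathbb N$). They are $\phi$-static if in addition each $\phi_i(t)=\phi_i$ is constant in $t$. Algorithm and look-compute-move cycle. An algorithm is a total function $\psi:\mathbb{R}^2\to\mathbb{R}^2$, used by both robots. A robot $r_i$ activated at time $t\in\mathbb N$ observes the other robot $r_{1-i}$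 at local coordinates $\mathbf p=Z_{(i,t)}(\mathbf r_{1-i}(t))$, and then moves in a straight line from $\mathbf r_i(t)$ toward the point whose coordinates in $Z_{(i,t)}$ are $\psi(\mathbf p)$ (its destination). The adversary may stop the move before the destination is reached, but the robot either reaches its destination or travels a distance at least $\delta$ (measured in $Z$), where $\delta>0$ is a fixed constant. Semi-synchronous execution. At every $t\in\mathbb N$ the adversary activates a nonempty subset of the robots; each activated robot performs its whole cycle instantaneously in the sense that look and compute happen at $t$ and the move finishes before $t+1$; a non-activated robot does not move between $t$ and $t+1$. An execution is the resulting infinite sequence $C(0),C(1),\dots$; it is required to be fair: each robot is activated infinitely many times. Gathering. An execution is a gathering execution if there are $\mathbf p\in\mathbb{R}^2$ and $f\in\mathbb N$ with $C(t)=(\mathbf p,\mathbf p)$ for all $t\ge f$. An algorithm is a gathering algorithm (it solves the gathering problem) if for every initial configuration $C(0)$, every execution starting from $C(0)$ is a gathering execution. Algorithm $A_{SS}^{\phi}$. For $\mathbf p\ne\mathbf 0$, $\arg(\mathbf p)$ is the polar angle $\omega\in[0,2\pi)$ with $\mathbf p=|\mathbf p|(\cos\omega,\sin\omega)$; angles are taken modulo $2\pi$ (so $\arg=2\pi$ means $\arg=0$). (Gathered) If $\mathbf p=\mathbf 0$ then $A_{SS}^{\phi}(\mathbf p)=\mathbf 0$. (Approach) If $0<\arg(\mathbf p)\le\pi$ then $A_{SS}^{\phi}(\mathbf p)=\mathbf p$. (Rotate) If $\pi<\arg(\mathbf p)\le 3\pi/2+\phi$ then $A_{SS}^{\phi}(\mathbf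 p)=(-|\mathbf p|,0)$. (Wait) If $3\pi/2+\phi<\arg(\mathbf p)\le 2\pi$ then $A_{SS}^{\phi}(\mathbf p)=\mathbf 0$. *)

(* Defs.v *)
From Stdlib Require Import Reals Lra ClassicalEpsilon.
Open Scope R_scope.

Definition point : Type := (R * R)%type.

Definition origin : point := (0, 0).

Definition padd (p q : point) : point := (fst p + fst q, snd p + snd q).
Definition psub (p q : point) : point := (fst p - fst q, snd p - snd q).
Definition pscale (a : R) (p : point) : point := (a * fst p, a * snd p).

Definition norm (p : point) : R := sqrt (fst p ^ 2 + snd p ^ 2).
Definition dist (p q : point) : R := norm (psub p q).

Definition is_arg (p : point) (w : R) : Prop :=
  0 <= w < 2 * PI /\ p = pscale (norm p) (cos w, sin w).

(** Only meaningful for [p <> origin]: existence and uniqueness of the polar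
    angle are [arg_spec] and [arg_unique] below. *)
Definition arg (p : point) : R := epsilon (inhabits 0) (is_arg p).

Lemma norm_pos (p : point) : p <> origin -> 0 < norm p.
Proof.
  destruct p as [x y]; unfold norm, origin; simpl; intros H.
  apply sqrt_lt_R0.
  destruct (Req_dec x 0) as [->|Hx].
  - assert (Hy : y <> 0) by (intros ->; apply H; reflexivity).
    pose proof (Rsqr_pos_lt y Hy) as Hy2; unfold Rsqr in Hy2; nra.
  - pose proof (Rsqr_pos_lt x Hx) as Hx2; unfold Rsqr in Hx2; nra.
Qed.

Lemma is_arg_exists (p : point) : p <> origin -> exists w, is_arg p w.
Proof.
  intros Hp; pose proof (norm_pos p Hp) as Hn.
  assert (Hn2 : norm p * norm p = fst p ^ 2 + snd p ^ 2)
    by (unfold norm; apply sqrt_sqrt; nra).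
  set (c := fst p / norm p); set (s := snd p / norm p).
  assert (Hc : fst p = norm p * c) by (unfold c; field; lra).
  assert (Hs : snd p = norm p * s) by (unfold s; field; lra).
  assert (H1 : c * c + s * s = 1).
  { rewrite Hc, Hs in Hn2.
    apply (Rmult_eq_reg_l (norm p * norm p)); nra. }
  assert (Hcb : -1 <= c <= 1) by nra.
  assert (Hpi := PI_RGT_0).
  destruct (acos_bound c) as [Ha0 Ha1].
  assert (Hsin : sin (acos c) = Rabs s).
  { rewrite sin_acos by exact Hcb.
    rewrite <- sqrt_Rsqr_abs; f_equal; unfold Rsqr; lra. }
  destruct (Rle_dec 0 s) as [Hs0|Hs0].
  - exists (acos c); split; [lra|].
    unfold pscale; simpl; rewrite cos_acos, Hsin, Rabs_right by lra.
    rewrite <- Hc, <- Hs; destruct p; reflexivity.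
  - exists (2 * PI - acos c).
    assert (Ha : acos c <> 0).
    { intros E; rewrite E, sin_0 in Hsin.
      rewrite Rabs_left in Hsin; lra. }
    split; [lra|].
    assert (Ec : cos (2 * PI - acos c) = c).
    { rewrite cos_minus, cos_2PI, sin_2PI, cos_acos by exact Hcb; ring. }
    assert (Es : sin (2 * PI - acos c) = s).
    { rewrite sin_minus, cos_2PI, sin_2PI, Hsin, Rabs_left by lra; ring. }
    unfold pscale; simpl; rewrite Ec, Es.
    rewrite <- Hc, <- Hs; destruct p; reflexivity.
Qed.

Lemma arg_spec (p : point) : p <> origin -> is_arg p (arg p).
Proof. intros Hp; unfold arg; apply epsilon_spec, is_arg_exists, Hp. Qed.

Lemma arg_unique (p : point) (w : R) : p <> origin -> is_arg p w -> arg p = w.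
Proof.
  intros Hp [Hw Ew]; destruct (arg_spec p Hp) as [Hv Ev].
  pose proof (norm_pos p Hp) as Hn; pose proof PI_RGT_0 as Hpi.
  set (v := arg p) in *; clearbody v.
  rewrite Ew in Ev at 1; unfold pscale in Ev; simpl in Ev.
  injection Ev as Hc Hs.
  apply Rmult_eq_reg_l in Hc; [|lra]; apply Rmult_eq_reg_l in Hs; [|lra].
  assert (H1 : cos (v - w) = 1).
  { rewrite cos_minus, Hc, Hs.
    pose proof (sin2_cos2 v) as H; unfold Rsqr in H; lra. }
  assert (H2 : cos (v - w) = 1 - 2 * sin ((v - w) / 2) * sin ((v - w) / 2)).
  { rewrite <- cos_2a_sin; f_equal; field. }
  assert (H3 : sin ((v - w) / 2) = 0) by nra.
  destruct (Rtotal_order v w) as [H|[H|H]]; [|exact H|].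
  - assert (0 < sin ((w - v) / 2)) by (apply sin_gt_0; lra).
    replace ((w - v) / 2) with (- ((v - w) / 2)) in * by field.
    rewrite sin_neg in *; lra.
  - assert (0 < sin ((v - w) / 2)) by (apply sin_gt_0; lra); lra.
Qed.

Inductive robot : Set := r0 | r1.

Definition other (i : robot) : robot :=
  match i with r0 => r1 | r1 => r0 end.

Definition config : Type := (point * point)%type.

Definition position (c : config) (i : robot) : point :=
  match i with r0 => fst c | r1 => snd c end.

(** Local coordinates of [p] for a robot at [r] with scaling ratio [s] and
    compass deviation [d]. *)
Definition local_coords (s d : R) (r p : point) : point :=
  let v := psub p r in
  pscale s (cos d * fst v + sin d * snd v, - sin d * fst v + cos d * snd v).

Definition algorithm : Type := point -> point.

(** The adversary may stop a move from [r] to [dest] at a point [r'] of the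
    segment, but not before a distance [delta] has been travelled. *)
Definition moves (delta : R) (r dest r' : point) : Prop :=
  (exists a, 0 <= a <= 1 /\ r' = padd r (pscale a (psub dest r))) /\
  (r' = dest \/ delta <= dist r r').

(** Since [s <> 0], [dest] is the unique point with the prescribed local
    coordinates. *)
Definition cycle (psi : algorithm) (delta s d : R) (r q r' : point) : Prop :=
  exists dest, local_coords s d r dest = psi (local_coords s d r q) /\
               moves delta r dest r'.

Definition compasses (phi : R) (dev : robot -> nat -> R) : Prop :=
  forall i t, Rabs (dev i t) <= phi.

Definition static_compasses (phi : R) (dev : robot -> nat -> R) : Prop :=
  compasses phi dev /\ forall i, exists d, forall t, dev i t = d.

(** [K] is the class of compass behaviours available to the adversary;
    [act t i] says that robot [i] is activated at time [t]. *)
Definition SS_execution (psi : algorithm) (delta : R)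
    (K : (robot -> nat -> R) -> Prop) (C : nat -> config) : Prop :=
  exists (sc dev : robot -> nat -> R) (act : nat -> robot -> Prop),
    (forall i t, 0 < sc i t) /\
    (forall i t, - PI < dev i t <= PI) /\
    K dev /\
    (forall t, exists i, act t i) /\
    (forall i n, exists t, (n <= t)%nat /\ act t i) /\
    (forall t i, act t i ->
       cycle psi delta (sc i t) (dev i t)
         (position (C t) i) (position (C t) (other i))
         (position (C (S t)) i)) /\
    (forall t i, ~ act t i -> position (C (S t)) i = position (C t) i).

Definition gathering_execution (C : nat -> config) : Prop :=
  exists (p : point) (f : nat), forall t, (f <= t)%nat -> C t = (p, p).

Definition SS_gathering_algorithm (psi : algorithm) (delta : R)
    (K : (robot -> nat -> R) -> Prop) : Prop :=
  forall (C0 : config) (C : nat -> config),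
    C 0%nat = C0 -> SS_execution psi delta K C -> gathering_execution C.

Definition point_eq_dec (p q : point) : {p = q} + {p <> q} :=
  excluded_middle_informative (p = q).

(** The cases are, in order, Gathered, Approach, Rotate and Wait.  The angle
    [2 * PI] of the Wait range is [arg p = 0], which falls in the last branch
    because the Approach and Rotate ranges exclude it. *)
Definition A_SS (phi : R) : algorithm := fun p =>
  if point_eq_dec p origin then origin
  else if Rlt_dec 0 (arg p) then
    if Rle_dec (arg p) PI then p
    else if Rle_dec (arg p) (3 * PI / 2 + phi) then (- norm p, 0)
    else origin
  else origin.

(* Main.v *)
(** Only the vector from one robot to the other matters; it is seen as [z] in the frame of the
    robot with the smaller compass deviation and as [w = turn c s z] in the frame of the other,
    where [c] and [s] are the cosine and sine of the difference [D] of the two deviations,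
    [0 <= D <= 2 phi < PI].  The modes of the two robots depend only on the directions of [z]
    and [w].  Since [D - phi < PI / 2], a robot 0 that waits sees robot 1 approach, so the two
    never wait together.  Approaching keeps or reverses the direction of [z], rotating turns [z]
    and [w] counterclockwise towards the waiting range; hence the pair of modes moves only
    downwards for [rank], apart from staying put.  No pair lasts forever: without rotation the
    distance shrinks by [delta] at each activation of an approaching robot, and with rotation the
    rotating robot pushes a slope (or, if both rotate, a coordinate) up to its bound. *)
Require Import Defs.
From Stdlib Require Import Reals Lra Lia Classical.
Open Scope R_scope.

(** * Modes, moves and phases of the relative vector *)

Inductive mode : Set := Approach | Rotate | Wait.

(* [f] and [g] stand for [cos phi] and [sin phi]: for a polar angle [w] in [(PI, 2 PI)], Rotate
   means [w - phi <= 3 PI / 2], that is [cos (w - phi) <= 0]. *)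
Definition in_mode (f g : R) (m : mode) (p : point) : Prop :=
  let (x, y) := p in
  match m with
  | Approach => 0 < y \/ (y = 0 /\ x < 0)
  | Rotate => y < 0 /\ x * f + y * g <= 0
  | Wait => (y < 0 /\ 0 < x * f + y * g) \/ (y = 0 /\ 0 < x)
  end.

(* Change of the vector from a robot to the other one, in the frame of the former, when it
   performs the fraction [t] of its move. *)
Definition pull (m : mode) (t : R) (p : point) : point :=
  match m with
  | Approach => pscale (- t) p
  | Rotate => (t * norm p, 0)
  | Wait => origin
  end.

(* An idle robot has [t = 0], but the argument needs no constraint on [t] in that case. *)
Definition admissible (delta : R) (act : Prop) (t : R) (p : point) : Prop :=
  0 <= t <= 1 /\ (act -> t = 1 \/ delta <= t * norm p).

(* Rotation by [- D] composed with [p |-> - p]: from the frame of robot 0 to that of robot 1. *)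
Definition turn (c s : R) (p : point) : point :=
  (- (c * fst p + s * snd p), s * fst p - c * snd p).

(** With [c, s] the cosine and sine of [D], and [f, g] those of [phi]: [turn_trivial] excludes
    [D = PI], and [turn_small] reads [cos (D - phi) > 0]. *)
Record frames (f g c s : R) : Prop := {
  unit_turn : c * c + s * s = 1;
  turn_nonneg : 0 <= s;
  turn_trivial : s = 0 -> c = 1;
  cos_bound_pos : 0 < f;
  turn_small : 0 < c * f + s * g }.

(** No mode holds at the origin, so nothing is required there; elsewhere each robot has exactly one
    mode and the quantifiers just name it. [turn c (- s)] takes the pull of robot 1 back to the
    frame of robot 0. *)
Definition step (delta f g c s : R) (act0 act1 : Prop) (z z' : point) : Prop :=
  forall m0 m1, in_mode f g m0 z -> in_mode f g m1 (turn c s z) ->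
  exists t0 t1, admissible delta act0 t0 z /\ admissible delta act1 t1 (turn c s z) /\
    z' = padd (padd z (pull m0 t0 z)) (turn c (- s) (pull m1 t1 (turn c s z))).

Definition in_phase (f g c s : R) (m : mode * mode) (z : point) : Prop :=
  in_mode f g (fst m) z /\ in_mode f g (snd m) (turn c s z).

Definition rank (m : mode * mode) : nat :=
  match m with
  | (Approach, Wait) | (Wait, Approach) => 0
  | (Rotate, Approach) => 1
  | (Rotate, Wait) => 2
  | (Rotate, Rotate) => 3
  | (Approach, Rotate) | (Approach, Approach) => 4
  | (Wait, _) => 5 (* impossible by [wait_imp_approach] *)
  end.

(** * Norms, turns and mode regions *)

Lemma norm_nonneg (p : point) : 0 <= norm p.
Proof. apply sqrt_pos. Qed.

Lemma norm_pscale (a : R) (p : point) : norm (pscale a p) = Rabs a * norm p.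
Proof.
  unfold norm, pscale; simpl fst; simpl snd.
  replace ((a * fst p) ^ 2 + (a * snd p) ^ 2) with (Rsqr a * (fst p ^ 2 + snd p ^ 2))
    by (unfold Rsqr; ring).
  rewrite sqrt_mult_alt by apply Rle_0_sqr; rewrite sqrt_Rsqr_abs; reflexivity.
Qed.

Lemma snd_le_norm (p : point) : - snd p <= norm p.
Proof.
  apply Rle_trans with (Rabs (snd p)).
  - rewrite <- Rabs_Ropp; apply RRle_abs.
  - unfold norm; rewrite <- sqrt_Rsqr_abs; apply sqrt_le_1_alt; unfold Rsqr; nra.
Qed.

Lemma norm_turn (c s : R) (p : point) :
  c * c + s * s = 1 -> norm (turn c s p) = norm p.
Proof.
  intros H; unfold norm, turn; simpl fst; simpl snd; f_equal.
  transitivity ((c * c + s * s) * (fst p ^ 2 + snd p ^ 2)); [ring|rewrite H; ring].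
Qed.

Lemma turn_turn (c s : R) (p : point) :
  c * c + s * s = 1 -> turn c (- s) (turn c s p) = p.
Proof.
  intros H; destruct p as [x y]; unfold turn; simpl; f_equal.
  - transitivity ((c * c + s * s) * x); [ring|rewrite H; ring].
  - transitivity ((c * c + s * s) * y); [ring|rewrite H; ring].
Qed.

Lemma turn_turn' (c s : R) (p : point) :
  c * c + s * s = 1 -> turn c s (turn c (- s) p) = p.
Proof.
  intros H; rewrite <- (Ropp_involutive s) at 1; apply turn_turn; lra.
Qed.

Lemma in_mode_exists (f g : R) (p : point) : p <> origin -> exists m, in_mode f g m p.
Proof.
  destruct p as [x y]; intros Hp.
  destruct (Rtotal_order y 0) as [Hy|[Hy|Hy]].
  - destruct (Rle_dec (x * f + y * g) 0); [exists Rotate | exists Wait]; simpl; lra.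
  - destruct (Rtotal_order x 0) as [Hx|[Hx|Hx]];
      [exists Approach; simpl; lra | subst; now elim Hp | exists Wait; simpl; lra].
  - exists Approach; simpl; lra.
Qed.

Lemma in_mode_unique (f g : R) (m m' : mode) (p : point) :
  in_mode f g m p -> in_mode f g m' p -> m = m'.
Proof. destruct p, m, m'; simpl; intros; (reflexivity || exfalso; lra). Qed.

Lemma in_mode_scale (f g a : R) (m : mode) (p : point) :
  0 < a -> in_mode f g m p -> in_mode f g m (pscale a p).
Proof.
  intros Ha; destruct p as [x y].
  assert (E : a * x * f + a * y * g = a * (x * f + y * g)) by ring.
  destruct m; simpl; rewrite ?E.
  - intros [H|[-> H]]; [left|right]; nra.
  - intros [H H']; split; nra.
  - intros [[H H']|[-> H]]; [left|right]; split; nra.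
Qed.

Lemma in_mode_nonzero (f g : R) (m : mode) (p : point) :
  in_mode f g m p -> p <> origin.
Proof. destruct p as [x y]; intros H [= -> ->]; destruct m; simpl in H; lra. Qed.

Lemma turn_pscale (c s a : R) (p : point) :
  turn c s (pscale a p) = pscale a (turn c s p).
Proof. destruct p; unfold turn, pscale; simpl; f_equal; ring. Qed.

(** In angles, [turn] adds [PI - D] and carries [(3 PI / 2 + phi, 2 PI]] to
    [(PI / 2 + phi - D, PI - D]] modulo [2 PI], which lies in [(0, PI]] because
    [D - phi < PI / 2]. *)
Lemma wait_imp_approach (f g c s : R) (z : point) :
  frames f g c s -> in_mode f g Wait z -> in_mode f g Approach (turn c s z).
Proof.
  intros [H1 H2 H3 H4 H5]; destruct z as [x y]; simpl.
  intros [[Hy Hw]|[-> Hx]].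
  - left.
    (* Multiplied by [f > 0], the new ordinate splits into two terms of known sign. *)
    assert (0 < f * (s * x - c * y)); [|nra].
    replace (f * (s * x - c * y)) with (s * (x * f + y * g) + (- y) * (c * f + s * g)) by ring.
    assert (0 < - y * (c * f + s * g)) by (apply Rmult_lt_0_compat; lra).
    assert (0 <= s * (x * f + y * g)) by (apply Rmult_le_pos; lra).
    lra.
  - destruct H2 as [H2|H2].
    + left; nra.
    + right; rewrite <- H2, H3 by lra; lra.
Qed.

Lemma phase_exists (f g c s : R) (z : point) :
  frames f g c s -> z <> origin -> exists m, in_phase f g c s m z.
Proof.
  intros F Hz.
  destruct (in_mode_exists f g z Hz) as [m0 H0].
  destruct (in_mode_exists f g (turn c s z)) as [m1 H1].
  - intros E; apply Hz; rewrite <- (turn_turn c s z) by apply F; rewrite E.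
    unfold turn, origin; simpl; f_equal; ring.
  - exists (m0, m1); split; assumption.
Qed.

Lemma in_phase_scale (f g c s a : R) (m : mode * mode) (z : point) :
  0 < a -> in_phase f g c s m z -> in_phase f g c s m (pscale a z).
Proof.
  intros Ha [H0 H1]; split; [|rewrite turn_pscale]; apply in_mode_scale; assumption.
Qed.

(** The Approach directions form a half-open half-turn, which contains no two opposite
    directions. *)
Lemma mode_opp (f g a : R) (p : point) :
  a < 0 -> in_mode f g Approach p -> ~ in_mode f g Approach (pscale a p).
Proof.
  intros Ha; destruct p as [x y]; simpl; intros [H|[-> H]] [H'|[H' H'']]; nra.
Qed.

(** * Evolution of the phase in one step *)

Definition non_rotating (m : mode * mode) : Prop := fst m <> Rotate /\ snd m <> Rotate.

(** Applying [turn c s] to the equation for [z'] gives the same step as seen by robot 1. *)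
Lemma step_phase (delta f g c s : R) (act0 act1 : Prop) (m : mode * mode) (z z' : point) :
  frames f g c s -> step delta f g c s act0 act1 z z' -> in_phase f g c s m z ->
  exists t0 t1, admissible delta act0 t0 z /\ admissible delta act1 t1 (turn c s z) /\
    z' = padd (padd z (pull (fst m) t0 z)) (turn c (- s) (pull (snd m) t1 (turn c s z))) /\
    turn c s z' = padd (padd (turn c s z) (pull (snd m) t1 (turn c s z)))
                       (turn c s (pull (fst m) t0 z)).
Proof.
  intros F S [H0 H1]; destruct (S _ _ H0 H1) as (t0 & t1 & A0 & A1 & E).
  exists t0, t1; split; [exact A0|split; [exact A1|split; [exact E|]]].
  rewrite E.
  set (p1 := pull (snd m) t1 (turn c s z)).
  rewrite <- (turn_turn' c s p1) at 2 by apply F.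
  unfold padd, turn; simpl; f_equal; ring.
Qed.

(** Without Rotate both pulls are multiples of [z], once the second is turned back. *)
Lemma non_rotating_step (delta f g c s : R) (act0 act1 : Prop) (m : mode * mode) (z z' : point) :
  frames f g c s -> step delta f g c s act0 act1 z z' -> in_phase f g c s m z ->
  non_rotating m ->
  exists t0 t1, admissible delta act0 t0 z /\ admissible delta act1 t1 z /\
    z' = pscale (1 - (match fst m with Approach => t0 | _ => 0 end)
                   - (match snd m with Approach => t1 | _ => 0 end)) z.
Proof.
  intros F S P [N0 N1].
  destruct (step_phase _ _ _ _ _ _ _ _ _ _ F S P) as (t0 & t1 & A0 & A1 & E & _).
  exists t0, t1.
  split; [exact A0|split].
  { unfold admissible in *; rewrite norm_turn in A1 by apply F; exact A1. }
  rewrite E; destruct F as [U _ _ _ _].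
  destruct m as [[] []], z as [x y]; simpl in N0, N1; try congruence; simpl;
    rewrite ?turn_pscale, ?turn_turn by exact U;
    unfold padd, pscale, turn, origin; simpl; f_equal; ring.
Qed.

(** If [z] is only scaled, the phase stays, the robots meet, or both cease to approach. Otherwise,
    after (Approach, Rotate) robot 1 does not approach, and after (Rotate, _) robot 0 does not;
    moreover robot 1 still approaches after (Rotate, Approach) and does not rotate after (Rotate,
    Wait). With [wait_imp_approach], only the same pair or pairs of lower rank remain. *)
Lemma rank_descends (delta f g c s : R) (act0 act1 : Prop) (m : mode * mode) (z z' : point) :
  frames f g c s -> step delta f g c s act0 act1 z z' -> in_phase f g c s m z ->
  z' = origin \/ in_phase f g c s m z' \/
  exists m', (rank m' < rank m)%nat /\ in_phase f g c s m' z'.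
Proof.
  intros F S P.
  destruct (classic (z' = origin)) as [|Hz']; [now left|right].
  destruct (phase_exists _ _ _ _ _ F Hz') as [m' P'].
  pose proof (wait_imp_approach _ _ _ _ z F) as WA.
  pose proof (wait_imp_approach _ _ _ _ z' F) as WA'.
  assert (X0 : fst m' = Wait -> snd m' = Approach).
  { intros E; destruct P' as [P0 P1]; rewrite E in P0.
    eapply in_mode_unique; [exact P1|exact (WA' P0)]. }
  assert (Y0 : fst m = Wait -> snd m = Approach).
  { intros E; destruct P as [P0 P1]; rewrite E in P0.
    eapply in_mode_unique; [exact P1|exact (WA P0)]. }
  enough (m' = m \/ (rank m' < rank m)%nat) as [->|]
    by (solve [now left | right; exists m'; now split]).
  clear WA WA'.
  destruct (classic (non_rotating m)) as [N|N].
  - destruct (non_rotating_step _ _ _ _ _ _ _ _ _ _ F S P N) as (t0 & t1 & [T0 _] & [T1 _] & E).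
    set (a := 1 - _ - _) in E.
    destruct (Rtotal_order 0 a) as [Ha|[Ha|Ha]].
    + left; destruct (in_phase_scale _ _ _ _ _ _ _ Ha P) as [Q0 Q1].
      rewrite <- E in Q0, Q1; destruct P' as [P0 P1].
      destruct m, m'; f_equal; eapply in_mode_unique; eassumption.
    + elim Hz'; rewrite E, <- Ha; unfold pscale, origin; f_equal; ring.
    (* A negative factor needs two approaching robots, since each fraction is at most [1]. *)
    + destruct P as [P0 P1], P' as [P0' P1']; rewrite E in P0', P1'; rewrite turn_pscale in P1'.
      destruct m as [m0 m1], m' as [m0' m1']; unfold non_rotating, a in *; clear a; cbn [fst snd] in *.
      destruct m0; [|now elim N|]; (destruct m1; [|now elim N|]);
        try lra; try (specialize (Y0 eq_refl); discriminate).
      assert (m0' <> Approach) by (intros ->; exact (mode_opp _ _ _ _ Ha P0 P0')).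
      assert (m1' <> Approach) by (intros ->; exact (mode_opp _ _ _ _ Ha P1 P1')).
      destruct m0', m1';
        solve [congruence | left; reflexivity | right; simpl; lia | now specialize (X0 eq_refl)].
  - destruct (step_phase _ _ _ _ _ _ _ _ _ _ F S P) as (t0 & t1 & [T0 _] & [T1 _] & E & E').
    destruct F as [U1 U2 U3 U4 U5].
    pose proof (norm_nonneg z) as N0.
    pose proof (norm_nonneg (turn c s z)) as N1.
    destruct m as [m0 m1], m' as [m0' m1'], P as [P0 P1], P' as [P0' P1'], z as [x y], z' as [x' y'].
    unfold non_rotating in N; simpl fst in *; simpl snd in *.
    destruct m0, m1; try (now elim N; split; discriminate); try (specialize (Y0 eq_refl); discriminate);
      cbn [pull] in E, E';
      set (n0 := norm (x, y)) in *; set (n1 := norm (turn c s (x, y))) in *; clearbody n0 n1.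
    (* [w] becomes [(1 - t0) w + (t1 * n1, 0)]: its ordinate vanishes only for [t0 = 1], and then
       its abscissa is nonnegative. *)
    + assert (m1' <> Approach).
      { intros ->; rewrite E' in P1'; rewrite turn_pscale in P1'.
        destruct (turn c s (x, y)) as [u v]; simpl in P1, P1'.
        assert (0 <= t1 * n1) by (apply Rmult_le_pos; lra).
        destruct P1 as [Hv _], P1' as [H'|[H' H'']]; [nra|].
        assert (t0 = 1) by nra; subst; nra. }
      destruct m0', m1';
        solve [congruence | left; reflexivity | right; simpl; lia | now specialize (X0 eq_refl)].
    + assert (H0 : 0 <= t0 * n0) by (apply Rmult_le_pos; lra).
      assert (m0' <> Approach).
      { intros ->; rewrite E in P0'.
        rewrite turn_pscale, turn_turn in P0' by exact U1; simpl in P0, P0'.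
        destruct P0 as [Hv _], P0' as [H'|[H' H'']]; [nra|].
        assert (t1 = 1) by nra; subst; nra. }
      (* [w] becomes [(1 - t1) w + k (- c, s)], where [w] and [(- c, s)] both lie in the convex cone
         of Approach directions. *)
      assert (m1' = Approach).
      { eapply in_mode_unique; [exact P1'|]; rewrite E'.
        rewrite turn_pscale, turn_turn in E by exact U1.
        simpl in E; set (k := t0 * n0) in *; clearbody k.
        destruct (Rle_lt_or_eq_dec t1 1) as [Ht|Ht]; [lra| |].
        - destruct (Rle_lt_or_eq_dec 0 s U2) as [Hs|Hs].
          + simpl in P1 |- *; destruct P1 as [H1|[H1 H1']].
            * left; assert (0 <= s * k) by (apply Rmult_le_pos; lra); nra.
            * destruct H0 as [H0|<-]; [left|right]; nra.
          + rewrite (U3 (eq_sym Hs)), <- Hs in *; simpl in P1 |- *.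
            destruct P1 as [H1|[H1 H1']]; [left|right]; nra.
        - subst t1.
          assert (0 < k).
          { destruct H0 as [|<-]; [assumption|].
            elim Hz'; rewrite E; unfold origin, padd; simpl; f_equal; ring. }
          destruct (Rle_lt_or_eq_dec 0 s U2) as [Hs|Hs].
          + left; simpl; nra.
          + rewrite (U3 (eq_sym Hs)), <- Hs in *; simpl; right; nra. }
      subst; destruct m0';
        solve [congruence | left; reflexivity | right; simpl; lia | now specialize (X0 eq_refl)].
    (* Both rotate: the ordinate of [z] decreases by [s * (t1 * n1)]. *)
    + assert (m0' <> Approach).
      { intros ->; rewrite E in P0'; simpl in P0, P0'.
        assert (0 <= t1 * n1) by (apply Rmult_le_pos; lra).
        assert (0 <= s * (t1 * n1)) by (apply Rmult_le_pos; lra).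
        destruct P0'; lra. }
      destruct m0', m1';
        solve [congruence | left; reflexivity | right; simpl; lia | now specialize (X0 eq_refl)].
    + assert (H0 : 0 <= t0 * n0) by (apply Rmult_le_pos; lra).
      rewrite E in P0'; rewrite E' in P1'; simpl in P0, P1, P0', P1'.
      set (k := t0 * n0) in *; clearbody k.
      assert (m0' <> Approach) by (intros ->; simpl in P0'; lra).
      assert (m1' <> Rotate).
      { intros ->; simpl in P1'.
        set (u := - (c * x + s * y)) in *; set (v := s * x - c * y) in *.
        assert (0 <= s * k) by (apply Rmult_le_pos; lra).
        destruct P1' as [Hv Hu], P1 as [[Hv1 Hu1]|[Hv1 Hu1]]; [|lra].
        (* [w] turns counterclockwise: its cross product with the new [w] is [- y * k]. *)
        assert (K : u * (v + s * k) - v * (u - c * k) = - y * k).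
        { unfold u, v; transitivity (- y * k * (c * c + s * s)); [ring|rewrite U1; ring]. }
        assert (0 <= - y * k) by (apply Rmult_le_pos; lra).
        assert (Hv2 : v + s * k < 0) by lra.
        assert (Hu2 : (u - c * k) * f + (v + s * k) * g <= 0) by lra.
        set (v' := v + s * k) in *; set (u' := u - c * k) in *; clearbody u' v' u v.
        clear Hv Hu.
        (* The first two products add up to [- f * (u * v' - v * u')], which contradicts the
           third. *)
        assert (0 < - v' * (u * f + v * g)) by (apply Rmult_lt_0_compat; lra).
        assert (0 <= - v * - (u' * f + v' * g)) by (apply Rmult_le_pos; lra).
        assert (0 <= f * (u * v' - v * u')) by (apply Rmult_le_pos; lra).
        nra. }
      destruct m0', m1';
        solve [congruence | left; reflexivity | right; simpl; lia | now specialize (X0 eq_refl)].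
Qed.

(** * No phase lasts forever *)

Definition fair (act : nat -> Prop) : Prop := forall n, exists t, (n <= t)%nat /\ act t.

(** Fairness supplies any number [k] of increments [eps], nothing is lost in between, and [k * eps]
    exceeds every bound. *)
Lemma progress_unbounded (mu : nat -> R) (act : nat -> Prop) (n0 : nat) (eps B : R) :
  0 < eps -> fair act ->
  (forall n, (n0 <= n)%nat -> mu n <= mu (S n) /\ (act n -> mu n + eps <= mu (S n))) ->
  ~ (forall n, (n0 <= n)%nat -> mu n <= B).
Proof.
  intros He F Hm Hb.
  assert (M : forall n k, (n0 <= n)%nat -> mu n <= mu (n + k)%nat).
  { intros n k Hn; induction k as [|k IH]; [rewrite Nat.add_0_r; lra|].
    rewrite Nat.add_succ_r; destruct (Hm (n + k)%nat) as [H _]; [lia|lra]. }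
  assert (U : forall k, exists n, (n0 <= n)%nat /\ mu n0 + INR k * eps <= mu n).
  { induction k as [|k [n [Hn IH]]].
    - exists n0; simpl; split; [lia|lra].
    - destruct (F n) as [t [Ht A]]; exists (S t); split; [lia|].
      destruct (Hm t) as [_ H]; [lia|].
      pose proof (M n (t - n)%nat Hn) as Hnt; replace (n + (t - n))%nat with t in Hnt by lia.
      specialize (H A); rewrite S_INR; lra. }
  destruct (INR_archimed eps (B - mu n0) He) as [k Hk].
  destruct (U k) as [n [Hn H]]; specialize (Hb n Hn); lra.
Qed.

Lemma antitone_from (q : nat -> R) (n0 : nat) :
  (forall n, (n0 <= n)%nat -> q (S n) <= q n) -> forall n, (n0 <= n)%nat -> q n <= q n0.
Proof.
  intros H n Hn; induction Hn as [|n Hn IH]; [lra|]; specialize (H n Hn); lra.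
Qed.

(* The slope [x / (- y)] grows by a fixed amount at each activation, because [- y] never
   increases, whereas [Rotate] bounds it by [tan phi = g / f]. *)
Lemma rotation_ends (delta f g : R) (act : nat -> Prop) (p : nat -> point) (n0 : nat) :
  0 < delta -> 0 < f -> fair act ->
  (forall n, (n0 <= n)%nat -> exists t a, admissible delta (act n) t (p n) /\ 0 <= a <= 1 /\
     p (S n) = (a * fst (p n) + t * norm (p n), a * snd (p n))) ->
  ~ (forall n, (n0 <= n)%nat -> in_mode f g Rotate (p n)).
Proof.
  intros Hd Hf F Hstep Hrot.
  assert (Hrot' : forall n, (n0 <= n)%nat ->
            0 < - snd (p n) /\ fst (p n) * f <= - snd (p n) * g).
  { intros n Hn; specialize (Hrot n Hn); destruct (p n); simpl in *; lra. }
  set (q := fun n => - snd (p n)).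
  assert (Hq : forall n, (n0 <= n)%nat -> q n <= q n0).
  { apply antitone_from; intros n Hn; unfold q.
    destruct (Hstep n Hn) as (t & a & _ & Ha & E); rewrite E; simpl.
    destruct (Hrot' n Hn); nra. }
  assert (Hq0 : 0 < q n0) by (apply Hrot'; lia).
  (* A completed move adds at least [1] to the slope, as [q n <= norm (p n)]; an interrupted one at
     least [delta / q n0], as [q n <= q n0]. *)
  apply (progress_unbounded (fun n => fst (p n) / q n) act n0 (Rmin 1 (delta / q n0)) (g / f)).
  - apply Rmin_pos; [lra|now apply Rdiv_lt_0_compat].
  - exact F.
  - intros n Hn.
    destruct (Hrot' n Hn) as [Hqn _]; destruct (Hrot' (S n)) as [Hqn' _]; [lia|].
    specialize (Hq n Hn).
    destruct (Hstep n Hn) as (t & a & [Ht Hact] & Ha & E).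
    pose proof (snd_le_norm (p n)) as Hm; pose proof (norm_nonneg (p n)) as Hm0.
    change (- snd (p n)) with (q n) in *.
    assert (Eq : q (S n) = a * q n) by (unfold q; rewrite E; simpl; ring).
    change (- snd (p (S n))) with (q (S n)) in *.
    assert (Ha0 : 0 < a) by nra.
    (* Contraction by [a] keeps the old slope and divides the added term by [a <= 1]. *)
    assert (G : fst (p n) / q n + t * norm (p n) / q n <= fst (p (S n)) / q (S n)).
    { rewrite Eq, E; simpl.
      replace ((a * fst (p n) + t * norm (p n)) / (a * q n))
        with (fst (p n) / q n + t * norm (p n) / q n * / a) by (field; lra).
      assert (0 <= t * norm (p n) / q n)
        by (apply Rmult_le_pos; [nra|apply Rlt_le, Rinv_0_lt_compat; lra]).
      assert (1 <= / a) by (rewrite <- Rinv_1; apply Rinv_le_contravar; lra).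
      nra. }
    assert (Hinv : 0 < / q n) by (apply Rinv_0_lt_compat; lra).
    split.
    + assert (0 <= t * norm (p n) / q n) by (apply Rmult_le_pos; [nra|lra]); lra.
    + intros A; apply Rle_trans with (2 := G), Rplus_le_compat_l.
      destruct (Hact A) as [->|Hmove].
      * apply Rle_trans with (1 := Rmin_l _ _), Rmult_le_reg_r with (q n); [exact Hqn|].
        unfold Rdiv; rewrite Rmult_assoc, Rinv_l; lra.
      * apply Rle_trans with (1 := Rmin_r _ _); unfold Rdiv.
        apply Rmult_le_compat; try lra.
        -- apply Rlt_le, Rinv_0_lt_compat, Hq0.
        -- apply Rinv_le_contravar; lra.
  - intros n Hn; destruct (Hrot' n Hn) as [Hqn Hx].
    apply Rmult_le_reg_r with (q n * f); [unfold q; nra|].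
    replace (fst (p n) / q n * (q n * f)) with (fst (p n) * f) by (field; unfold q; lra).
    replace (g / f * (q n * f)) with (q n * g) by (field; lra).
    exact Hx.
Qed.

(** A factor [a <= 0] would leave Approach, so no activation has [t = 1], and each one shortens the
    vector by at least [delta]. *)
Lemma approach_ends (delta f g : R) (act : nat -> Prop) (p : nat -> point) (n0 : nat) :
  0 < delta -> fair act ->
  (forall n, (n0 <= n)%nat -> exists t a, admissible delta (act n) t (p n) /\
     a <= 1 - t /\ p (S n) = pscale a (p n)) ->
  ~ (forall n, (n0 <= n)%nat -> in_mode f g Approach (p n)).
Proof.
  intros Hd F Hstep Happ.
  apply (progress_unbounded (fun n => - norm (p n)) act n0 delta 0 Hd F);
    [|intros n _; pose proof (norm_nonneg (p n)); lra].
  intros n Hn; destruct (Hstep n Hn) as (t & a & [Ht Hact] & Ha & E).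
  pose proof (Happ n Hn) as P; pose proof (Happ (S n)) as P'.
  rewrite E in P' |- *.
  assert (Ha0 : 0 < a).
  { destruct (Rtotal_order a 0) as [H|[->|H]]; [| |exact H].
    - elim (mode_opp _ _ _ _ H P); apply P'; lia.
    - elim (in_mode_nonzero f g Approach (pscale 0 (p n))); [apply P'; lia|].
      unfold pscale, origin; f_equal; ring. }
  rewrite norm_pscale, Rabs_right by lra.
  pose proof (norm_nonneg (p n)) as N.
  split; [nra|].
  intros A; destruct (Hact A); [lra|nra].
Qed.

(* [- snd (z n)] increases by a fixed amount at each activation of the second robot, but is
   bounded in terms of [snd (turn c s (z n))], whose absolute value never increases. *)
Lemma joint_rotation_ends (delta f g c s : R) (act0 act1 : nat -> Prop) (z : nat -> point)
    (n0 : nat) :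
  0 < delta -> frames f g c s -> fair act1 ->
  (forall n, step delta f g c s (act0 n) (act1 n) (z n) (z (S n))) ->
  ~ (forall n, (n0 <= n)%nat -> in_phase f g c s (Rotate, Rotate) (z n)).
Proof.
  intros Hd F F1 S P.
  (* For [s = 0] the two views are opposite, so they cannot both have a negative ordinate. *)
  assert (Hs : 0 < s).
  { destruct F as [U1 U2 U3 U4 U5].
    destruct (Rle_lt_or_eq_dec _ _ U2) as [H|H]; [exact H|].
    destruct (P n0 (le_n _)) as [H0 H1]; destruct (z n0); simpl in *.
    rewrite (U3 (eq_sym H)), <- H in *; lra. }
  assert (Hstep : forall n, (n0 <= n)%nat -> exists t0 t1,
    0 <= t0 /\ admissible delta (act1 n) t1 (z n) /\
    snd (z (Datatypes.S n)) = snd (z n) - s * (t1 * norm (z n)) /\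
    snd (turn c s (z (Datatypes.S n))) = snd (turn c s (z n)) + s * (t0 * norm (z n))).
  { intros n Hn.
    destruct (step_phase _ _ _ _ _ _ _ _ _ _ F (S n) (P n Hn))
      as (t0 & t1 & [A0 _] & A1 & E & E'); exists t0, t1.
    unfold admissible in A1 |- *; simpl pull in E, E'; rewrite norm_turn in A1, E, E' by apply F.
    rewrite E', E; split; [apply A0|split; [exact A1|]]; simpl; split; ring. }
  clear S.
  set (y := fun n => - snd (z n)); set (v := fun n => - snd (turn c s (z n))).
  assert (Hy : forall n, (n0 <= n)%nat -> 0 < y n /\ - y n <= - y n0).
  { intros n Hn; split.
    - destruct (P n Hn) as [H _]; unfold y; destruct (z n); simpl in *; lra.
    - revert n Hn; apply (antitone_from (fun n => - y n)); intros n Hn; unfold y.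
      destruct (Hstep n Hn) as (t0 & t1 & _ & [T _] & -> & _).
      pose proof (norm_nonneg (z n)).
      assert (0 <= s * (t1 * norm (z n))) by (repeat apply Rmult_le_pos; lra); lra. }
  assert (Hv : forall n, (n0 <= n)%nat -> v n <= v n0).
  { apply antitone_from; intros n Hn; unfold v.
    destruct (Hstep n Hn) as (t0 & t1 & T & _ & _ & ->).
    pose proof (norm_nonneg (z n)).
    assert (0 <= s * (t0 * norm (z n))) by (repeat apply Rmult_le_pos; lra); lra. }
  assert (Hy0 : 0 < y n0) by (apply Hy; lia).
  (* A completed move adds [s * norm (z n)], at least [s * y n0]; an interrupted one at least
     [s * delta]. *)
  apply (progress_unbounded y act1 n0 (s * Rmin delta (y n0)) (v n0 * (Rabs (s * g - c * f) / f))).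
  - apply Rmult_lt_0_compat; [exact Hs|now apply Rmin_pos].
  - exact F1.
  - intros n Hn; destruct (Hstep n Hn) as (t0 & t1 & _ & [T A] & E & _).
    assert (Ey : y (S n) = y n + s * (t1 * norm (z n))) by (unfold y; rewrite E; ring).
    rewrite Ey; pose proof (norm_nonneg (z n)); split.
    + assert (0 <= s * (t1 * norm (z n))) by (repeat apply Rmult_le_pos; lra); lra.
    + intros H'; apply Rplus_le_compat_l, Rmult_le_compat_l; [lra|].
      destruct (A H') as [->|A'].
      * apply Rle_trans with (1 := Rmin_r _ _).
        pose proof (snd_le_norm (z n)); destruct (Hy n Hn); unfold y in *; lra.
      * apply Rle_trans with (1 := Rmin_l _ _); exact A'.
  - intros n Hn; specialize (Hv n Hn); destruct (P n Hn) as [_ P1].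
    destruct F as [U1 _ _ U4 _].
    apply Rmult_le_reg_r with f; [exact U4|].
    replace (v n0 * (Rabs (s * g - c * f) / f) * f) with (v n0 * Rabs (s * g - c * f))
      by (field; lra).
    assert (E : y n = s * fst (turn c s (z n)) - c * v n).
    { unfold y, v; rewrite <- (turn_turn c s (z n)) at 1 by exact U1; simpl; ring. }
    unfold v in *; destruct (turn c s (z n)) as [a b]; simpl in *.
    destruct P1 as [Hb Ha].
    rewrite E.
    (* Rotate for robot 1 gives [a * f <= - b * g], hence [y n * f <= - b * (s * g - c * f)]; the
       absolute value allows [- b] to be replaced by the larger [v n0]. *)
    apply Rle_trans with (- b * Rabs (s * g - c * f)); [|apply Rmult_le_compat_r; [apply Rabs_pos|lra]].
    assert (s * (a * f + b * g) <= 0) by nra.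
    pose proof (RRle_abs (s * g - c * f)).
    nra.
Qed.

(** Some robot approaches or rotates, and its own view of the other robot is the sequence to follow.
    An approach by the partner of a single rotating robot contributes the factor [1 - t]. *)
Lemma phase_ends (delta f g c s : R) (act0 act1 : nat -> Prop) (z : nat -> point)
    (m : mode * mode) (n0 : nat) :
  0 < delta -> frames f g c s -> fair act0 -> fair act1 ->
  (forall n, step delta f g c s (act0 n) (act1 n) (z n) (z (S n))) ->
  ~ (forall n, (n0 <= n)%nat -> in_phase f g c s m (z n)).
Proof.
  intros Hd F F0 F1 St P.
  assert (WA : fst m = Wait -> snd m = Approach).
  { intros E; destruct (P n0 (le_n _)) as [P0 P1]; rewrite E in P0.
    eapply in_mode_unique; [exact P1|exact (wait_imp_approach _ _ _ _ _ F P0)]. }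
  destruct (classic (non_rotating m)) as [N|N].
  - assert (Sc : forall n, (n0 <= n)%nat -> exists t0 t1,
      admissible delta (act0 n) t0 (z n) /\ admissible delta (act1 n) t1 (z n) /\
      z (S n) = pscale (1 - (match fst m with Approach => t0 | _ => 0 end)
                          - (match snd m with Approach => t1 | _ => 0 end)) (z n)).
    { intros n Hn; exact (non_rotating_step _ _ _ _ _ _ _ _ _ _ F (St n) (P n Hn) N). }
    destruct N as [N0 N1].
    destruct (fst m) eqn:E0; [|now elim N0|].
    + apply (approach_ends delta f g act0 z n0 Hd F0).
      * intros n Hn; destruct (Sc n Hn) as (t0 & t1 & A0 & [A1 _] & E).
        eexists t0, _; split; [exact A0|split; [|exact E]].
        destruct (snd m); lra.
      * intros n Hn; rewrite <- E0; apply P, Hn.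
    + rewrite (WA eq_refl) in Sc.
      apply (approach_ends delta f g act1 (fun n => turn c s (z n)) n0 Hd F1).
      * intros n Hn; destruct (Sc n Hn) as (t0 & t1 & _ & A1 & E).
        eexists t1, _; split; [|split; [|rewrite E; apply turn_pscale]]; [|lra].
        unfold admissible in *; rewrite norm_turn by apply F; exact A1.
      * intros n Hn; rewrite <- (WA eq_refl); apply P, Hn.
  - destruct m as [m0 m1]; simpl in WA.
    destruct m0, m1; try (now elim N; split; discriminate);
      try (specialize (WA eq_refl); discriminate).
    + apply (rotation_ends delta f g act1 (fun n => turn c s (z n)) n0 Hd (cos_bound_pos _ _ _ _ F) F1).
      * intros n Hn.
        destruct (step_phase _ _ _ _ _ _ _ _ _ _ F (St n) (P n Hn))
          as (t0 & t1 & [A0 _] & A1 & _ & E).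
        exists t1, (1 - t0); split; [exact A1|split; [lra|]].
        rewrite E; simpl pull; rewrite turn_pscale; unfold padd, pscale; simpl; f_equal; ring.
      * intros n Hn; apply P, Hn.
    + apply (rotation_ends delta f g act0 z n0 Hd (cos_bound_pos _ _ _ _ F) F0).
      * intros n Hn.
        destruct (step_phase _ _ _ _ _ _ _ _ _ _ F (St n) (P n Hn))
          as (t0 & t1 & A0 & [A1 _] & E & _).
        exists t0, (1 - t1); split; [exact A0|split; [lra|]].
        rewrite E; simpl pull; rewrite turn_pscale, turn_turn by apply F.
        unfold padd, pscale; simpl; f_equal; ring.
      * intros n Hn; apply P, Hn.
    + exact (joint_rotation_ends _ _ _ _ _ _ _ _ _ Hd F F1 St P).
    + apply (rotation_ends delta f g act0 z n0 Hd (cos_bound_pos _ _ _ _ F) F0).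
      * intros n Hn.
        destruct (step_phase _ _ _ _ _ _ _ _ _ _ F (St n) (P n Hn))
          as (t0 & t1 & A0 & _ & E & _).
        exists t0, 1; split; [exact A0|split; [lra|]].
        rewrite E; unfold padd, turn; simpl; f_equal; ring.
      * intros n Hn; apply P, Hn.
Qed.

(** * The relative vector reaches the origin *)

Lemma eventually_origin (delta f g c s : R) (act0 act1 : nat -> Prop) (z : nat -> point) :
  0 < delta -> frames f g c s -> fair act0 -> fair act1 ->
  (forall n, step delta f g c s (act0 n) (act1 n) (z n) (z (S n))) ->
  exists n, z n = origin.
Proof.
  intros Hd F F0 F1 St.
  destruct (classic (z 0%nat = origin)) as [|H]; [now exists 0%nat|].
  destruct (phase_exists _ _ _ _ _ F H) as [m P]; clear H.
  revert m P; generalize 0%nat as n.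
  enough (G : forall k n m, (rank m < k)%nat -> in_phase f g c s m (z n) ->
              exists n', z n' = origin) by (intros n m; exact (G _ n m (Nat.lt_succ_diag_r _))).
  (* Induction on a bound for the rank: if the origin were never reached, a drop of rank would
     contradict [IH], so the phase would last forever. *)
  induction k as [|k IH]; intros n m Hk P; [lia|].
  apply NNPP; intros C.
  apply (phase_ends _ _ _ _ _ _ _ _ m n Hd F F0 F1 St).
  intros n' Hn; induction Hn as [|n' Hn IHn]; [exact P|].
  destruct (rank_descends _ _ _ _ _ _ _ _ _ _ F (St n') IHn) as [E|[Q|(m' & Hm & Q)]].
  - elim C; now exists (S n').
  - exact Q.
  - elim C; apply (IH (S n') m'); [lia|exact Q].
Qed.

(** * From local coordinates to the relative vector *)

Lemma local_coords_scale (s d : R) (r q : point) :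
  local_coords s d r q = pscale s (local_coords 1 d r q).
Proof. unfold local_coords, pscale; simpl; f_equal; ring. Qed.

Lemma norm_local_coords (d : R) (r q : point) : norm (local_coords 1 d r q) = norm (psub q r).
Proof.
  unfold norm, local_coords, pscale, psub; cbn [fst snd]; f_equal.
  pose proof (sin2_cos2 d) as H; unfold Rsqr in H.
  set (a := fst q - fst r); set (b := snd q - snd r).
  transitivity ((sin d * sin d + cos d * cos d) * (a ^ 2 + b ^ 2)); [ring|rewrite H; ring].
Qed.

Lemma norm_eq_0 (p : point) : norm p = 0 -> p = origin.
Proof.
  intros H; apply NNPP; intros Hp; pose proof (norm_pos p Hp); lra.
Qed.

Lemma psub_eq_origin (p q : point) : psub p q = origin -> p = q.
Proof.
  destruct p, q; unfold psub, origin; simpl; intros H; injection H as H1 H2; f_equal; lra.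
Qed.

Lemma norm_origin : norm origin = 0.
Proof. transitivity (sqrt 0); [unfold norm; f_equal; simpl; ring|exact sqrt_0]. Qed.

Lemma local_coords_origin (s d : R) (r q : point) :
  0 < s -> local_coords s d r q = origin -> q = r.
Proof.
  intros Hs H; apply psub_eq_origin, norm_eq_0; rewrite <- (norm_local_coords d).
  rewrite local_coords_scale in H; apply (f_equal norm) in H.
  rewrite norm_pscale, norm_origin, Rabs_right in H by lra.
  apply Rmult_integral in H; lra.
Qed.

(** This homogeneity makes the scaling ratios irrelevant: they can all be replaced by [1]. *)
Lemma pull_scale (a t : R) (m : mode) (p : point) :
  0 < a -> pull m t (pscale a p) = pscale a (pull m t p).
Proof.
  intros Ha; destruct m; simpl; try (rewrite norm_pscale, Rabs_right by lra);
    unfold pscale, origin; simpl; f_equal; ring.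
Qed.

Lemma pull_linear (t : R) (m : mode) (p : point) : pull m t p = pscale t (pull m 1 p).
Proof. destruct m; unfold pull, pscale, origin; simpl; f_equal; ring. Qed.

(** The sign is reversed because a displacement of the observer is subtracted from the vector
    towards the other robot. *)
Lemma A_SS_mode (phi : R) (p : point) : 0 <= phi < PI / 2 -> p <> origin ->
  exists m, in_mode (cos phi) (sin phi) m p /\ A_SS phi p = pscale (-1) (pull m 1 p).
Proof.
  intros Hphi Hp; destruct (arg_spec p Hp) as [Hw Ep].
  pose proof (norm_pos p Hp) as Hn; pose proof PI_RGT_0 as Hpi.
  unfold A_SS; destruct (point_eq_dec p origin) as [|_]; [contradiction|].
  assert (K : forall m, in_mode (cos phi) (sin phi) m (cos (arg p), sin (arg p)) ->
                   in_mode (cos phi) (sin phi) m p).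
  { intros m H; rewrite Ep; now apply in_mode_scale. }
  set (w := arg p) in *; clearbody w.
  pose proof (cos_minus w phi) as C.
  destruct (Rlt_dec 0 w) as [H0|H0].
  - destruct (Rle_dec w PI) as [H1|H1].
    + exists Approach; split.
      * apply K; destruct (Rle_lt_or_eq_dec _ _ H1) as [H| ->].
        -- left; apply sin_gt_0; lra.
        -- right; rewrite sin_PI, cos_PI; lra.
      * destruct p; unfold pull, pscale; simpl; f_equal; ring.
    + assert (sin w < 0) by (apply sin_lt_0; lra).
      destruct (Rle_dec w (3 * PI / 2 + phi)) as [H2|H2].
      * exists Rotate; split.
        -- apply K; split; [assumption|].
           (* [w - phi] lies in [[PI / 2, 3 PI / 2]], since [w > PI] and [phi < PI / 2]. *)
           rewrite <- C; apply cos_le_0; lra.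
        -- unfold pull, pscale; simpl; f_equal; ring.
      * exists Wait; split.
        -- apply K; left; split; [assumption|].
           rewrite <- C, <- cos_neg.
           (* [2 PI - (w - phi)] lies in [(0, PI / 2)]. *)
           replace (- (w - phi)) with (- (w - phi) + 2 * PI - 2 * PI) by ring.
           rewrite cos_minus, cos_2PI, sin_2PI, Rmult_1_r, Rmult_0_r, Rplus_0_r.
           apply cos_gt_0; lra.
        -- unfold pull, pscale, origin; simpl; f_equal; ring.
  - exists Wait; split.
    + apply K; right; replace w with 0 by lra; rewrite sin_0, cos_0; lra.
    + unfold pull, pscale, origin; simpl; f_equal; ring.
Qed.

Lemma pscale_inj (a : R) (p q : point) : a <> 0 -> pscale a p = pscale a q -> p = q.
Proof.
  intros Ha; destruct p, q; unfold pscale; simpl; intros H; injection H as H1 H2.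
  apply Rmult_eq_reg_l in H1; [|exact Ha]; apply Rmult_eq_reg_l in H2; [|exact Ha].
  congruence.
Qed.

(** The witness is the travelled fraction [a], or [1] if the destination is reached. In the former
    case [a] times the length of the full move is at least [delta], and that length is at most the
    observed distance in every mode. *)
Lemma cycle_pull (phi delta s d : R) (r q r' : point) (m : mode) :
  0 <= phi < PI / 2 -> 0 < s -> cycle (A_SS phi) delta s d r q r' ->
  in_mode (cos phi) (sin phi) m (local_coords 1 d r q) ->
  exists t, admissible delta True t (local_coords 1 d r q) /\
    local_coords 1 d r r' = pscale (-1) (pull m t (local_coords 1 d r q)).
Proof.
  intros Hphi Hs (dest & Edest & (a & Ha & Er') & Hstop) Hm.
  rewrite (local_coords_scale s d r q), (local_coords_scale s d r dest) in Edest.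
  set (p := local_coords 1 d r q) in *.
  assert (Hm' := in_mode_scale _ _ _ _ _ Hs Hm).
  destruct (A_SS_mode phi (pscale s p) Hphi (in_mode_nonzero _ _ _ _ Hm')) as (m' & Hm2 & E).
  rewrite (in_mode_unique _ _ _ _ _ Hm2 Hm') in E.
  rewrite E, pull_scale in Edest by exact Hs.
  assert (Ed : local_coords 1 d r dest = pscale (-1) (pull m 1 p)).
  { apply pscale_inj with s; [lra|]; rewrite Edest.
    unfold pscale; simpl; f_equal; ring. }
  destruct (classic (r' = dest)) as [->|Hr'].
  - exists 1; split; [|exact Ed]; split; [lra|intros _; now left].
  - exists a; split.
    + split; [exact Ha|intros _; right].
      destruct Hstop as [|Hstop]; [contradiction|].
      apply Rle_trans with (1 := Hstop).
      replace (Defs.dist r r') with (a * norm (psub dest r)).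
      * apply Rmult_le_compat_l; [lra|].
        rewrite <- (norm_local_coords d), Ed, norm_pscale, (Rabs_left (-1)) by lra.
        replace (- -1) with 1 by ring; rewrite Rmult_1_l.
        destruct m; simpl.
        -- rewrite norm_pscale, Rabs_Ropp, Rabs_R1; lra.
        -- replace (1 * norm p, 0) with (pscale (norm p) (1, 0))
             by (unfold pscale; simpl; f_equal; ring).
           rewrite norm_pscale, Rabs_right by (apply Rle_ge, norm_nonneg).
           replace (norm (1, 0)) with 1; [lra|].
           symmetry; transitivity (sqrt 1); [unfold norm; f_equal; simpl; ring|exact sqrt_1].
        -- rewrite norm_origin; apply norm_nonneg.
      * unfold Defs.dist; rewrite Er'.
        replace (psub r (padd r (pscale a (psub dest r)))) with (pscale (- a) (psub dest r))
          by (unfold psub, padd, pscale; simpl; f_equal; ring).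
        rewrite norm_pscale, Rabs_Ropp, Rabs_right by lra; reflexivity.
    + rewrite pull_linear.
      transitivity (pscale a (local_coords 1 d r dest)).
      * rewrite Er'; unfold local_coords, pscale, psub, padd; simpl; f_equal; ring.
      * rewrite Ed; unfold pscale; simpl; f_equal; ring.
Qed.

Lemma cycle_gathered (phi delta s d : R) (r r' : point) :
  0 < s -> cycle (A_SS phi) delta s d r r r' -> r' = r.
Proof.
  intros Hs (dest & Edest & (a & _ & Er') & _).
  assert (E : local_coords s d r r = origin)
    by (unfold local_coords, pscale, psub, origin; simpl; f_equal; ring).
  rewrite E in Edest; unfold A_SS in Edest.
  destruct (point_eq_dec origin origin) as [_|C]; [|now elim C].
  apply local_coords_origin in Edest; [|exact Hs].
  rewrite Er', Edest; destruct r; unfold padd, pscale, psub; simpl; f_equal; ring.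
Qed.

(** [D = d1 - d0] lies in [[0, 2 phi]], within [[0, PI)], so its sine vanishes only at [0]; and
    [D - phi] lies in [[- phi, phi]]. *)
Lemma frames_of_compasses (phi d0 d1 : R) :
  0 <= phi < PI / 2 -> Rabs d0 <= phi -> Rabs d1 <= phi -> d0 <= d1 ->
  frames (cos phi) (sin phi) (cos (d1 - d0)) (sin (d1 - d0)).
Proof.
  intros Hphi H0 H1 Hd; pose proof PI_RGT_0 as Hpi.
  pose proof (RRle_abs d1) as L1; pose proof (RRle_abs (- d0)) as L0; rewrite Rabs_Ropp in L0.
  split.
  - pose proof (sin2_cos2 (d1 - d0)) as H; unfold Rsqr in H; lra.
  - apply sin_ge_0; lra.
  - intros H; destruct (Rle_lt_or_eq_dec _ _ Hd) as [L| <-].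
    + assert (0 < sin (d1 - d0)) by (apply sin_gt_0; lra); lra.
    + rewrite Rminus_diag, cos_0; reflexivity.
  - apply cos_gt_0; lra.
  - rewrite <- cos_minus; apply cos_gt_0; lra.
Qed.

(** Four points are allowed so that it covers both the vector between the robots and the
    displacement of a single robot. *)
Lemma local_coords_turn (d0 d1 : R) (q0 q1 p q : point) :
  psub p q0 = pscale (-1) (psub q q1) ->
  local_coords 1 d1 q1 q = turn (cos (d1 - d0)) (sin (d1 - d0)) (local_coords 1 d0 q0 p).
Proof.
  intros E; unfold local_coords; rewrite E.
  set (u := psub q q1); clearbody u.
  pose proof (sin2_cos2 d0) as H; unfold Rsqr in H.
  rewrite cos_minus, sin_minus; unfold turn, pscale; simpl; f_equal.
  - transitivity ((sin d0 * sin d0 + cos d0 * cos d0) * (cos d1 * fst u + sin d1 * snd u));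
      [rewrite H; ring|ring].
  - transitivity ((sin d0 * sin d0 + cos d0 * cos d0) * (- sin d1 * fst u + cos d1 * snd u));
      [rewrite H; ring|ring].
Qed.

(** * Every execution gathers *)

Lemma other_other (i : robot) : other (other i) = i.
Proof. now destruct i. Qed.

Theorem theorem2 (phi delta : R) (Hphi : 0 <= phi < PI / 2) (Hdelta : 0 < delta) :
  SS_gathering_algorithm (A_SS phi) delta (static_compasses phi).
Proof.
  intros C0 C _ (sc & dev & act & Hsc & _ & [Hbound Hstatic] & _ & Hfair & Hact & Hidle).
  destruct (Hstatic r0) as [d0 D0], (Hstatic r1) as [d1 D1].
  (* Constant deviations are ordered the same way at all times; [j] is the robot with the smaller
     one. *)
  assert (J : exists j e0 e1, (forall t, dev j t = e0) /\ (forall t, dev (other j) t = e1) /\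
                e0 <= e1).
  { destruct (Rle_dec d0 d1); [exists r0, d0, d1 | exists r1, d1, d0]; simpl; repeat split;
      (assumption || lra). }
  clear d0 d1 D0 D1; destruct J as (j & d0 & d1 & D0 & D1 & Hd).
  set (k := other j) in *.
  assert (F : frames (cos phi) (sin phi) (cos (d1 - d0)) (sin (d1 - d0))).
  { apply frames_of_compasses; [exact Hphi| | |exact Hd].
    - rewrite <- (D0 0%nat); apply Hbound.
    - rewrite <- (D1 0%nat); apply Hbound. }
  (* An active robot follows [cycle_pull]; an idle one takes the fraction [0], where the pull
     vanishes. *)
  assert (Move : forall i d t m, dev i t = d ->
    in_mode (cos phi) (sin phi) m
      (local_coords 1 d (position (C t) i) (position (C t) (other i))) ->
    exists a, admissible delta (act t i) a
        (local_coords 1 d (position (C t) i) (position (C t) (other i))) /\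
      local_coords 1 d (position (C t) i) (position (C (S t)) i) =
      pscale (-1) (pull m a (local_coords 1 d (position (C t) i) (position (C t) (other i))))).
  { intros i d t m Ed Hm; destruct (classic (act t i)) as [A|A].
    - pose proof (Hact t i A) as Cy; rewrite Ed in Cy.
      destruct (cycle_pull _ _ _ _ _ _ _ _ Hphi (Hsc i t) Cy Hm) as (a & [Ha Ha'] & E).
      exists a; split; [split; [exact Ha|intros _; now apply Ha']|exact E].
    - exists 0; split; [split; [lra|contradiction]|].
      rewrite (Hidle t i A), pull_linear.
      unfold local_coords, psub, pscale; simpl; f_equal; ring. }
  set (z := fun t => local_coords 1 d0 (position (C t) j) (position (C t) k)).
  destruct (eventually_origin delta (cos phi) (sin phi) (cos (d1 - d0)) (sin (d1 - d0))
              (fun t => act t j) (fun t => act t k) z Hdelta F) as [n Hn].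
  - intros n; apply Hfair.
  - intros n; apply Hfair.
  - intros t m0 m1 H0 H1.
    assert (Ew : turn (cos (d1 - d0)) (sin (d1 - d0)) (z t) =
                 local_coords 1 d1 (position (C t) k) (position (C t) (other k))).
    { symmetry; apply local_coords_turn; unfold k; rewrite other_other.
      unfold psub, pscale; simpl; f_equal; ring. }
    rewrite Ew in H1 |- *.
    destruct (Move j d0 t m0 (D0 t) H0) as (t0 & A0 & E0).
    destruct (Move k d1 t m1 (D1 t) H1) as (t1 & A1 & E1).
    exists t0, t1; split; [exact A0|split; [exact A1|]].
    fold k in E0; change (local_coords 1 d0 (position (C t) j) (position (C t) k)) with (z t) in E0.
    set (p0 := pull m0 t0 (z t)) in *; clearbody p0.
    set (p1 := pull m1 t1 _) in *; clearbody p1.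
    (* The pull of [k] is its displacement in the frame of [j], turned; turning back leaves a sum of
       displacements in one frame. *)
    assert (E1' : p1 = turn (cos (d1 - d0)) (sin (d1 - d0))
                        (local_coords 1 d0 (position (C t) k) (position (C (S t)) k))).
    { rewrite (local_coords_turn d0 d1 (position (C (S t)) k) _ (position (C t) k)) in E1
        by (unfold psub, pscale; simpl; f_equal; ring).
      apply (pscale_inj (-1)); [lra|]; rewrite <- E1, <- turn_pscale; f_equal.
      unfold local_coords, pscale, psub; simpl; f_equal; ring. }
    rewrite E1', turn_turn by apply F.
    apply (f_equal (pscale (-1))) in E0.
    assert (E0' : p0 = pscale (-1) (local_coords 1 d0 (position (C t) j) (position (C (S t)) j))).
    { rewrite E0; destruct p0; unfold pscale; simpl; f_equal; ring. }
    rewrite E0'; unfold z, local_coords, pscale, padd, psub; simpl; f_equal; ring.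
  - assert (G : position (C n) k = position (C n) j)
      by (apply (local_coords_origin 1 d0); [lra|exact Hn]).
    set (p := position (C n) j) in *.
    (* Robots that have met see the origin and stay. *)
    assert (G' : forall t, (n <= t)%nat -> forall i, position (C t) i = p).
    { intros t Ht; induction Ht as [|t Ht IH]; intros i.
      - unfold k, p in *; destruct i, j; simpl in *; congruence.
      - destruct (classic (act t i)) as [A|A].
        + pose proof (Hact t i A) as Cy; rewrite !IH in Cy.
          exact (cycle_gathered _ _ _ _ _ _ (Hsc i t) Cy).
        + rewrite (Hidle t i A); apply IH. }
    exists p, n; intros t Ht.
    pose proof (G' t Ht r0) as Q0; pose proof (G' t Ht r1) as Q1; simpl in Q0, Q1.
    destruct (C t); simpl in *; congruence.
Qed.
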